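(* Let $\mathcal{D}_n := \frac{1}{n!}\sum_{\pi\in S_n}\langle\pi\rangle$ and $\mathcal{D}'_n := \frac{1}{n!}\sum_{\rho\in S_n}\langle\rho0\rangle$ for $n\ge 1$. Then the sequence $(\mathcal{D}'_{n-1}/n)_{n=2}^{\infty}$ is monotonically increasing (in the weak sense, i.e. $\mathcal{D}'_{n-1}/n\le \mathcal{D}'_{n}/(n+1)$ for all $n\ge 2$), and it converges to $\lim_{n\to\infty}\mathcal{D}_n/n$ (in particular, this last limit exists).
   Context: Permutations are written in one-line notation, as words in distinct integers; $S_n$ is the set of permutations of $\{1,\dots,n\}$. For $\rho\in S_n$, $\rho0$ denotes the concatenation of $\rho$ with the letter $0$, a word in the letters $0,1,\dots,n$ ending in $0$. West's stack-sorting map $s$ takes a permutation (a finite word of distinct integers) $\pi$ to another arrangement $s(\pi)$ of the same letters, as follows. Start with an empty stack and an empty output word, and read $\pi$ from left to right. At each step, if there is a next unread entry of $\pi$ and either the stack is empty or the top element of the stack is greater than that next entry, push that next entry onto the stack; otherwise, pop the top element of the stack and append it to the right end of the output. The procedure ends when all entries have been appended to the output, and $s(\pi)$ is the output word. The stack-sorting depth $\langle\pi\rangle$ is the minimum integer $k\ge 0$ such that $s^k(\pi)$ (the $k$-fold iterate) is sorted, i.e. its entries are in increasing order. *)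

(* Defs.v *)
From mathcomp Require Import all_boot all_order all_algebra.
From mathcomp Require Import reals.
From mathcomp Require Import zify.

Set Implicit Arguments.
Unset Strict Implicit.
Unset Printing Implicit Defensive.

Import Order.TTheory GRing.Theory Num.Theory.
Local Open Scope ring_scope.

(* A configuration is (stack, unread input, output); the head of the stack is
   its top. *)
Definition stack_config : Type := (seq nat * seq nat * seq nat)%type.

Definition stack_step (c : stack_config) : stack_config :=
  let: (st, inp, out) := c in
  match inp, st with
  | x :: inp', [::] => ([:: x], inp', out)
  | x :: inp', t :: st' =>
      if (x < t)%N then (x :: st, inp', out) else (st', inp, rcons out t)
  | [::], t :: st' => (st', [::], rcons out t)
  | [::], [::] => c
  end.

(* Each letter is pushed once and popped once, so the procedure stops after
   exactly 2 * size w steps (see stack_sort_halts). *)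
Definition stack_sort (w : seq nat) : seq nat :=
  (iter (2 * size w) stack_step ([::], w, [::])).2.

Lemma stack_halts n st inp out :
  n = (size st + 2 * size inp)%N ->
  exists2 o, iter n stack_step (st, inp, out) = ([::], [::], out ++ o)
           & perm_eq o (st ++ inp).
Proof.
elim: n st inp out => [|n IH] st inp out.
  by case: st inp => [|a st] [|x inp] //= _; exists [::]; rewrite ?cats0.
rewrite iterSr; case: inp => [|x inp] /= E.
  case: st E => [|t st] /= E; first by lia.
  have [|o -> Po] := IH st [::] (rcons out t); first by rewrite /=; lia.
  by exists (t :: o); rewrite ?cat_rcons //= perm_cons.
case: st E => [|t st] /= E.
  have [|o -> Po] := IH [:: x] inp out; first by rewrite /=; lia.
  by exists o.
case: ifP => _.
  have [|o -> Po] := IH [:: x, t & st] inp out; first by rewrite /=; lia.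
  exists o => //; apply: (perm_trans Po).
  by rewrite -[t :: st ++ _]/((t :: st) ++ _) perm_sym -(cat1s x inp) perm_catCA.
have [|o -> Po] := IH st (x :: inp) (rcons out t); first by rewrite /=; lia.
by exists (t :: o); rewrite ?cat_rcons //= perm_cons.
Qed.

Lemma stack_sort_halts (w : seq nat) :
  iter (2 * size w) stack_step ([::], w, [::]) = ([::], [::], stack_sort w).
Proof.
have [o E P] := @stack_halts (2 * size w) [::] w [::] erefl.
by rewrite /stack_sort E.
Qed.

Lemma perm_stack_sort (w : seq nat) : perm_eq (stack_sort w) w.
Proof.
have [o E P] := @stack_halts (2 * size w) [::] w [::] erefl.
by rewrite /stack_sort E.
Qed.

Lemma stack_tail st T out :
  sorted leq T -> all (fun t => all (leq^~ t) st) T ->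
  (iter (size st + 2 * size T) stack_step (st, T, out)).2 = out ++ st ++ T.
Proof.
elim: T st out => [|t T IHT].
  move=> st out _ _; rewrite muln0 addn0.
  elim: st out => [|a st IH] out; first by rewrite !cats0.
  by rewrite iterSr /= IH cat_rcons.
elim=> [|a st IH] out sT; last first.
  move=> aT; have at_ : (a <= t)%N by case/andP: aT => /andP[].
  rewrite addSn iterSr /= ltnNge at_ /= IH ?cat_rcons //.
  by apply: sub_all aT => u /andP[].
move=> _; rewrite -[(_ + _)%N]/((2 * (size T).+1)%N).
have -> : (2 * (size T).+1 = (size [:: t] + 2 * size T).+1)%N by rewrite /=; lia.
rewrite iterSr; apply: (IHT [:: t] out); first exact: path_sorted sT.
by apply: sub_all (order_path_min leq_trans sT) => u tu; rewrite /= tu.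
Qed.

Lemma stack_cat n st U T out :
  n = (size st + 2 * size U)%N -> sorted leq T ->
  all (fun t => all (leq^~ t) (st ++ U)) T ->
  (iter (n + 2 * size T) stack_step (st, U ++ T, out)).2 =
  (iter n stack_step (st, U, out)).2 ++ T.
Proof.
elim: n st U out => [|n IH] st [|x U] out En sT aT.
- by case: st En aT => // _ aT; apply: (@stack_tail [::]).
- by move: En => /=; lia.
- rewrite muln0 addn0 in En; rewrite cats0 in aT.
  rewrite cat0s En stack_tail // catA; congr (_ ++ _).
  have := @stack_tail st [::] out isT isT.
  by rewrite muln0 addn0 cats0 => ->.
- rewrite addSn !iterSr; case: st En aT => [|t st] En aT /=.
    by rewrite -IH //=; move: En => /=; lia.
  case: ifP => _; rewrite -IH //; try by move: En => /=; lia.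
    apply: sub_all aT => u; rewrite !all_cat /= => /andP[/andP[-> ->]].
    by move=> /andP[-> ->].
  by apply: sub_all aT => u /andP[].
Qed.

Lemma stack_last n st inp out o :
  n = (size st + 2 * size inp)%N -> sorted leq st ->
  iter n stack_step (st, inp, out) = ([::], [::], out ++ o) ->
  all (leq^~ (last 0%N o)) (st ++ inp).
Proof.
elim: n st inp out o => [|n IH] st inp out o.
  by case: st inp => [|a st] [|x inp] //=.
move=> + sst; rewrite iterSr; case: inp => [|x inp] E.
  case: st E sst => [|t st] E sst; first by move: E => /=; lia.
  rewrite /= => H.
  have [|o' E' P'] := @stack_halts n st [::] (rcons out t); first by move: E => /=; lia.
  rewrite E' in H; case: H => /eqP; rewrite cat_rcons eqseq_cat // eqxx /=.
  move=> /eqP Eo; subst o.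
  case: st E sst E' P' => [|b st] E sst E' P'.
    by move/perm_size: P'; case: o' E' => //=; rewrite leqnn.
  have /(_ o') := IH (b :: st) [::] (rcons out t).
  have En : n = (size (b :: st) + 2 * size (Nil nat))%N by move: E => /=; lia.
  move=> /(_ En (path_sorted sst) E').
  have -> : last 0%N (t :: o') = last 0%N o'.
    by case: o' E' P' => [|c o'] // _ /perm_size.
  move=> A; apply/andP; split; last exact: A.
  by case/andP: sst => tb _; case/andP: A => bl _; apply: leq_trans tb bl.
case: st E sst => [|t st] E sst /=.
  by move=> H; have := IH _ _ _ _ _ _ H; apply=> //; move: E => /=; lia.
case: ltnP => xt H.
  have En : n = (size [:: x, t & st] + 2 * size inp)%N by move: E => /=; lia.
  have sx : sorted leq [:: x, t & st] by rewrite /= (ltnW xt).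
  by have := IH _ _ _ _ En sx H; rewrite /= !all_cat /= => /and4P[-> -> -> ->].
have [|o' E' P'] := @stack_halts n st (x :: inp) (rcons out t); first by move: E => /=; lia.
rewrite E' in H; case: H => /eqP; rewrite cat_rcons eqseq_cat // eqxx /=.
move=> /eqP Eo; subst o.
have En : n = (size st + 2 * size (x :: inp))%N by move: E => /=; lia.
have := IH _ _ _ _ En (path_sorted sst) E'.
have -> : last 0%N (t :: o') = last 0%N o'.
  case: o' E' P' => [|c o'] // _ /perm_size; rewrite size_cat /=; lia.
move=> A; rewrite A andbT.
move: A; rewrite all_cat => /andP[_ /andP[xl _]]; exact: leq_trans xt xl.
Qed.

Lemma stack_sort_cat U T :
  sorted leq T -> all (fun t => all (leq^~ t) U) T ->
  stack_sort (U ++ T) = stack_sort U ++ T.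
Proof.
by move=> sT aT; rewrite /stack_sort size_cat mulnDr (@stack_cat _ [::]).
Qed.

Lemma stack_sort_last w : all (leq^~ (last 0%N (stack_sort w))) (stack_sort w).
Proof.
rewrite (perm_all _ (perm_stack_sort w)).
exact: (@stack_last (2 * size w) [::] w [::] _ erefl isT (stack_sort_halts w)).
Qed.

Lemma iter_stack_sort k w : exists U T,
  [/\ iter k stack_sort w = U ++ T, sorted leq T,
      all (fun t => all (leq^~ t) U) T & size U = (size w - k)%N].
Proof.
elim: k => [|k [U [T [E sT aT sU]]]].
  by exists w, [::]; rewrite cats0 subn0.
have PU := perm_stack_sort U.
rewrite iterS E stack_sort_cat //.
have := stack_sort_last U; case/lastP: (stack_sort U) PU => [|V m] PU.
  exists [::], T; split=> //; first by apply/allP.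
  by move/perm_size: PU; rewrite /= sU => sw; rewrite subnS -sw.
rewrite last_rcons all_rcons => /andP[_ aV].
have {}aT : all (fun t => all (leq^~ t) (rcons V m)) T.
  by apply: sub_all aT => t; rewrite (perm_all _ PU).
exists V, (m :: T); split.
- by rewrite cat_rcons.
- rewrite /= path_min_sorted //; apply: sub_all aT => t.
  by rewrite all_rcons => /andP[].
- rewrite /= aV; apply: sub_all aT => t.
  by rewrite all_rcons => /andP[].
- by move/perm_size: PU; rewrite size_rcons sU subnS => <-.
Qed.

Lemma stack_sort_sorts (w : seq nat) :
  exists k, sorted leq (iter k stack_sort w).
Proof.
exists (size w); have [U [T [-> sT _]]] := iter_stack_sort (size w) w.
by rewrite subnn => /size0nil ->.
Qed.

(* On words of distinct letters, being sorted for leq means being strictly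
   increasing; leq makes the minimum exist for every word. *)
Definition depth (w : seq nat) : nat := ex_minn (stack_sort_sorts w).

(* permutations (iota 1 n) lists each one-line word of S_n exactly once. *)
Definition avg_depth (R : realType) (n : nat) : R :=
  (\sum_(w <- permutations (iota 1 n)) (depth w)%:R) / (n`!)%:R.

Definition avg_depth0 (R : realType) (n : nat) : R :=
  (\sum_(w <- permutations (iota 1 n)) (depth (rcons w 0%N))%:R) / (n`!)%:R.

(* Main.v *)
Require Import Defs.
From mathcomp Require Import all_boot all_order all_algebra.
From mathcomp Require Import all_classical all_reals all_analysis.
From mathcomp Require Import zify ring lra.

(** The key is to follow a single letter i of a word w. Only two things matter
    about its position: the subword v = [larger_before i w] of the letters
    that are larger than i and stand to its left. When i is read it goes on
    top of the stack, above all of v that is still there, and from then on no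
    larger letter leaves the stack before i does. So after one pass the larger
    letters to the left of i are exactly those which were output while v was
    being read, that is, [early v]. A word of distinct letters is sorted
    exactly when all these subwords are empty; hence the depth of w is the
    maximum over i of the clearing time of [larger_before i w], the number of
    times [early] must be applied to reach the empty word ([depthP]). Clearing
    times can only drop when the word is cut to a prefix or to its large
    letters. Therefore the depth of w0, where 0 sees all of w, is the clearing
    time c(w) ([depth_rcons_min]), and the depth of w is at most c(w).

    A permutation of n + 1 letters is obtained from one of n letters, w, by
    inserting a new smallest letter into one of n + 1 slots. This raises c by
    0 or 1, and it does raise it when fewer than c(w) letters stand to the
    left of the slot: such a short prefix is cleared before the rest of w is,
    so the new letter comes to the front while a larger letter still stands to
    its right, and one more pass is needed ([clearing_time_ins_ge]). At least
    c(w) of the n + 1 slots raise c, so D'_(n+1) >= D'_n + D'_n / (n + 1),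
    which is the monotonicity. As c(w) <= n, the sequence is bounded and
    converges.

    It remains to see that D'_n - D_n = o(n). Fix r and let w' be the prefix
    of w that omits the last r letters. The pattern of w' is uniformly
    distributed ([sum_take]), so c(w') has mean D'_(n-r), which is at least
    D'_n - r. Build w by successive insertions: the gap max(0, c(w') -
    depth(w)) grows by at most 1 at each step, and it falls back to 0 when the
    new smallest letter lands among the last r letters, because all of w' then
    consists of larger letters to its left. The mean gap is thus at most n / r
    ([sum_gap]). Hence |D_n - D'_(n-1)| <= r + n / r, and r is arbitrary. *)

Set Implicit Arguments.
Unset Strict Implicit.
Unset Printing Implicit Defensive.

Import Order.TTheory GRing.Theory Num.Theory.
Import numFieldNormedType.Exports.

(** * One pass of the stack, letter by letter *)

(** The state is (stack, output). The stack increases from its top, so the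
    letters popped by x are all those that are at most x: a filter replaces
    the pops, which makes the pass commute with keeping the large letters. *)
Definition read_letter (c : seq nat * seq nat) (x : nat) :=
  (x :: [seq t <- c.1 | x < t], c.2 ++ [seq t <- c.1 | t <= x]).

Definition run (w : seq nat) := foldl read_letter ([::], [::]) w.

(** The output at the moment when the whole input has been read, before the
    final emptying of the stack. *)
Definition early (w : seq nat) : seq nat := (run w).2.

Lemma run_rcons w x : run (rcons w x) = read_letter (run w) x.
Proof. by rewrite /run -cats1 foldl_cat. Qed.

Lemma foldl_read_letter_out st out w :
  (foldl read_letter (st, out) w).2 = out ++ (foldl read_letter (st, [::]) w).2.
Proof.
elim: w st out => [|x w IH] st out /=; first by rewrite cats0.
by rewrite IH [in RHS]IH catA.
Qed.

Lemma iter_stack_step_read_letter n st inp out :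
  n = (size st + 2 * size inp)%N -> sorted ltn st ->
  (iter n stack_step (st, inp, out)).2 =
  (foldl read_letter (st, out) inp).2 ++ (foldl read_letter (st, out) inp).1.
Proof.
elim: n st inp out => [|n IH] st [|x inp] out.
- by case: st => //= _ _; rewrite cats0.
- by move=> En; exfalso; move: En => /=; lia.
- case: st => [|t st] // [En] st_lt; rewrite iterSr /=.
  by rewrite IH ?cat_rcons ?(path_sorted st_lt) //= En.
- move=> En st_lt; rewrite iterSr; case: st En st_lt => [|t st] En st_lt /=.
    by rewrite /read_letter /= cats0 IH //; move: En => /=; lia.
  have t_lt := order_path_min ltn_trans st_lt.
  case: ltnP => xt.
    have x_lt : all (ltn x) (t :: st).
      by rewrite /= xt; apply: sub_all t_lt => y; apply: ltn_trans.
    have -> : read_letter (t :: st, out) x = ([:: x, t & st], out).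
      rewrite /read_letter (all_filterP x_lt).
      rewrite (@eq_in_filter _ _ pred0) ?filter_pred0 ?cats0 //.
      by move=> y /(allP x_lt) /=; rewrite ltnNge => /negbTE.
    by rewrite IH //=; [move: En => /=; lia | rewrite xt].
  rewrite IH ?(path_sorted st_lt) //; last by move: En => /=; lia.
  by rewrite /= /read_letter /= xt ltnNge xt /= cat_rcons.
Qed.

Lemma stack_sortE w : stack_sort w = early w ++ (run w).1.
Proof. exact: iter_stack_step_read_letter. Qed.

Lemma perm_early_run w : perm_eq (early w ++ (run w).1) w.
Proof. by rewrite -stack_sortE perm_stack_sort. Qed.

Lemma all_early a w : all a w -> all a (early w).
Proof. by rewrite -(perm_all _ (perm_early_run w)) all_cat => /andP[]. Qed.

Lemma size_early w : size (early w) <= (size w).-1.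
Proof.
case/lastP: w => // w x; rewrite -(perm_size (perm_early_run (rcons w x))).
by rewrite run_rcons size_cat /= addnS /= leq_addr.
Qed.

Lemma early_cat v w : exists t, early (v ++ w) = early v ++ t.
Proof.
rewrite /early /run foldl_cat; case: (foldl _ _ v) => st out.
by rewrite foldl_read_letter_out; eexists.
Qed.

(** Reading a letter below a moves only letters below it, and these are erased
    by the filter; so small letters never influence the large ones. *)
Lemma run_filter a w :
  run [seq y <- w | a <= y] =
  ([seq y <- (run w).1 | a <= y], [seq y <- (run w).2 | a <= y]).
Proof.
elim/last_ind: w => // w x IH; rewrite filter_rcons run_rcons.
case: (leqP a x) => ax; rewrite ?run_rcons IH /read_letter /=.
  rewrite ax filter_cat -!filter_predI.
  by congr (_ :: _, _ ++ _); apply: eq_filter => y /=; lia.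
rewrite leqNgt ax /= filter_cat -!filter_predI; congr (_ , _).
  by apply: eq_filter => y /=; lia.
rewrite -[LHS]cats0; congr (_ ++ _).
by rewrite (@eq_filter _ _ pred0) ?filter_pred0 // => y /=; lia.
Qed.

Lemma run_map g w : {mono g : x y / x <= y} ->
  run (map g w) = (map g (run w).1, map g (run w).2).
Proof.
move=> g_mono; elim/last_ind: w => // w x IH.
rewrite map_rcons !run_rcons IH /read_letter /= map_cat !filter_map.
by congr (_ , _); congr (_ :: _) || congr (_ ++ _); congr map;
  apply: eq_filter => y /=; rewrite ?ltnNge g_mono.
Qed.

Lemma early_filter a w : early [seq y <- w | a <= y] = [seq y <- early w | a <= y].
Proof. by rewrite /early run_filter. Qed.

Lemma stack_sort_filter a w :
  stack_sort [seq y <- w | a <= y] = [seq y <- stack_sort w | a <= y].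
Proof. by rewrite !stack_sortE /early run_filter filter_cat. Qed.

Lemma early_map g w : {mono g : x y / x <= y} -> early (map g w) = map g (early w).
Proof. by move=> g_mono; rewrite /early run_map. Qed.

(** A letter smaller than everything before it pops nothing, so it sits on top
    of the untouched stack. *)
Lemma run_rcons_min a v : all (ltn a) v -> run (rcons v a) = (a :: (run v).1, early v).
Proof.
move=> av; have := av.
rewrite -(perm_all _ (perm_early_run v)) all_cat run_rcons /read_letter => /andP[_ ast].
rewrite -[in RHS](cats0 (early v)) (all_filterP ast).
rewrite (@eq_in_filter _ _ pred0) ?filter_pred0 //.
by move=> y /(allP ast) /=; lia.
Qed.

Lemma early_rcons_min a v : all (ltn a) v -> early (rcons v a) = early v.
Proof. by rewrite {1}/early => /run_rcons_min ->. Qed.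

(** Such a letter a is popped by the very next letter b, hence follows [early v]
    in the output and otherwise leaves the pass unchanged. This is
    the recursion behind all results on insertion. *)
Lemma early_insert_min a v b w : all (ltn a) v -> a <= b ->
  exists t, early (v ++ a :: b :: w) = early v ++ a :: t /\
            early (v ++ b :: w) = early v ++ t.
Proof.
move=> av ab; rewrite -cat_rcons /early /run !foldl_cat -!/(run _) run_rcons_min //=.
set st := (run v).1; set out := early v.
have -> : read_letter (a :: st, out) b =
    (b :: [seq t <- st | b < t], out ++ a :: [seq t <- st | t <= b]).
  by rewrite /read_letter /= ltnNge ab.
eexists; split; first by rewrite foldl_read_letter_out -catA.
by rewrite /= [read_letter (run v) b]surjective_pairing foldl_read_letter_out -catA.
Qed.

(** * Clearing times and the depth *)

Lemma size_iter_early k w : size (iter k early w) <= size w - k.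
Proof.
elim: k => [|k IH]; first by rewrite subn0.
by rewrite iterS; apply: leq_trans (size_early _) _; lia.
Qed.

Lemma early_clears w : exists k, iter k early w == [::].
Proof.
exists (size w).
by rewrite -size_eq0 -leqn0 -(subnn (size w)) size_iter_early.
Qed.

(** For a word w of positive letters this is the number of passes that the
    final 0 of w0 needs to reach the front. *)
Definition clearing_time (w : seq nat) : nat := ex_minn (early_clears w).

Lemma clearing_timeP w k : (clearing_time w <= k) = (iter k early w == [::]).
Proof.
rewrite /clearing_time; case: ex_minnP => m /eqP m_clears m_min.
apply/idP/idP; last exact: m_min.
move/subnK => <-; rewrite iterD m_clears.
by elim: (k - m) => // n /eqP; rewrite iterS => ->.
Qed.

Lemma iter_clearing_time w : iter (clearing_time w) early w = [::].
Proof. by apply/eqP; rewrite -clearing_timeP. Qed.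

Lemma clearing_time_le_size w : clearing_time w <= size w.
Proof.
by rewrite clearing_timeP -size_eq0 -leqn0 -(subnn (size w)) size_iter_early.
Qed.

Lemma clearing_time_nil : clearing_time [::] = 0.
Proof. by apply/eqP; rewrite -leqn0 clearing_time_le_size. Qed.

Lemma iter_early_cat k v w : exists t, iter k early (v ++ w) = iter k early v ++ t.
Proof.
elim: k => [|k [t IH]]; first by exists w.
by rewrite !iterS IH; apply: early_cat.
Qed.

Lemma clearing_time_cat v w : clearing_time v <= clearing_time (v ++ w).
Proof.
rewrite clearing_timeP; have [t E] := iter_early_cat (clearing_time (v ++ w)) v w.
by move: (iter_clearing_time (v ++ w)); rewrite E; case: (iter _ _ v).
Qed.

Lemma clearing_time_filter a w : clearing_time [seq y <- w | a <= y] <= clearing_time w.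
Proof.
have E k : iter k early [seq y <- w | a <= y] = [seq y <- iter k early w | a <= y].
  by elim: k => // k IH; rewrite !iterS IH early_filter.
by rewrite clearing_timeP E iter_clearing_time.
Qed.

Lemma clearing_time_map g w : {mono g : x y / x <= y} ->
  clearing_time (map g w) = clearing_time w.
Proof.
move=> g_mono.
have E k : iter k early (map g w) = map g (iter k early w).
  by elim: k => // k IH; rewrite !iterS IH early_map.
have nilE k : (clearing_time (map g w) <= k) = (clearing_time w <= k).
  by rewrite !clearing_timeP E -!size_eq0 size_map.
by apply/eqP; rewrite eqn_leq nilE leqnn -nilE leqnn.
Qed.

(** The letters smaller than i are removed first, so that i is the minimum of
    the word in which its prefix is taken; its position can then be followed
    through a pass by [early_insert_min]. *)
Definition larger_before (i : nat) (w : seq nat) : seq nat :=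
  let u := [seq y <- w | i <= y] in take (index i u) u.

Lemma larger_before_cat i v w :
  all (leq i) w -> all (ltn i) v -> larger_before i (v ++ i :: w) = v.
Proof.
move=> iw iv; rewrite /larger_before filter_cat /= leqnn (all_filterP iw).
have /all_filterP -> : all (leq i) v by apply: sub_all iv => y /ltnW.
rewrite index_cat /= eqxx addn0 take_size_cat //.
by case: ifP => // /(allP iv); rewrite /= ltnn.
Qed.

Lemma larger_before_filter i w :
  larger_before i [seq y <- w | i <= y] = larger_before i w.
Proof. by rewrite /larger_before filter_id. Qed.

Lemma larger_beforeE i w : i \in w ->
  exists t, [seq y <- w | i <= y] = larger_before i w ++ i :: t /\ all (leq i) t.
Proof.
move=> iw; rewrite /larger_before /=; set u := [seq y <- w | i <= y].
have iu : i \in u by rewrite mem_filter leqnn.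
exists (drop (index i u).+1 u); split.
  by rewrite -{1}(cat_take_drop (index i u) u) (drop_nth i) ?index_mem // nth_index.
by apply/allP => y /mem_drop; rewrite mem_filter => /andP[].
Qed.

Lemma all_larger_before i w : all (ltn i) (larger_before i w).
Proof.
apply/allP => y; rewrite /larger_before /=; set u := [seq y <- w | i <= y] => yt.
have : y \in u by exact: mem_take yt.
rewrite mem_filter /= => /andP[iy _]; rewrite ltn_neqAle iy andbT.
apply/eqP => Ei; have : index y u < index i u; last by rewrite Ei ltnn.
by move: yt; rewrite in_take_leq ?index_size.
Qed.

(** After restriction to the letters that are at least i, the letter i pops
    nothing and leaves the stack before every letter larger than it; what is
    output ahead of it is what was output before it was read. *)
Lemma larger_before_stack_sort i w : i \in w ->
  larger_before i (stack_sort w) = early (larger_before i w).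
Proof.
move=> iw; have [t [E it]] := larger_beforeE iw; have iv := all_larger_before i w.
rewrite -larger_before_filter -stack_sort_filter E.
suff [t' Et'] : exists t',
    stack_sort (larger_before i w ++ i :: t) = early (larger_before i w) ++ i :: t'.
  have : all (leq i) (stack_sort (larger_before i w ++ i :: t)).
    rewrite (perm_all _ (perm_stack_sort _)) all_cat /= leqnn it !andbT.
    by apply: sub_all iv => y /ltnW.
  rewrite Et' all_cat /= => /and3P[_ _ it'].
  by rewrite larger_before_cat ?all_early.
rewrite stack_sortE; case: t it {E} => [|b t] /= => [_|/andP[ib _]].
  by rewrite cats1 early_rcons_min // run_rcons_min //; eexists.
have [t' [-> _]] := early_insert_min t iv ib.
by rewrite -catA; eexists.
Qed.

Lemma sorted_larger_before w : uniq w ->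
  sorted leq w = all (fun i => larger_before i w == [::]) w.
Proof.
elim: w => // x w IH /andP[xw uw].
have bx : larger_before x (x :: w) = [::] by rewrite /larger_before /= leqnn /= eqxx.
rewrite [LHS](path_sortedE leq_trans) IH // [RHS]/= bx eqxx andTb -all_predI.
apply: eq_in_all => i iw /=.
rewrite /larger_before /=; case: (leqP i x) => ix /=; last by rewrite (ltnW ix).
have nix : (x == i) = false by apply: contraNF xw => /eqP ->.
by rewrite nix /= leqNgt ltn_neqAle ix andbT eq_sym nix.
Qed.

Lemma iter_stack_sort_larger_before k i w : i \in w ->
  larger_before i (iter k stack_sort w) = iter k early (larger_before i w).
Proof.
move=> iw; elim: k => // k IH; rewrite !iterS -IH larger_before_stack_sort //.
elim: {IH} k => // k IH; rewrite iterS (perm_mem (perm_stack_sort _)) //.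
Qed.

(** Iterating [larger_before_stack_sort], the k-th iterate is sorted exactly
    when every [larger_before i w] has been cleared within k passes. *)
Lemma depthP w k : uniq w ->
  (depth w <= k) = all (fun i => clearing_time (larger_before i w) <= k) w.
Proof.
move=> uw.
have perm_iter j : perm_eq (iter j stack_sort w) w.
  by elim: j => // j IH; apply: perm_trans (perm_stack_sort _) IH.
have sortE j : sorted leq (iter j stack_sort w) =
    all (fun i => clearing_time (larger_before i w) <= j) w.
  rewrite sorted_larger_before ?(perm_uniq (perm_iter j)) // (perm_all _ (perm_iter j)).
  by apply: eq_in_all => i iw; rewrite iter_stack_sort_larger_before // clearing_timeP.
rewrite /depth -sortE; case: ex_minnP => m m_sorts m_min.
apply/idP/idP; last exact: m_min.
move=> mk; rewrite sortE; move: m_sorts; rewrite sortE; apply: sub_all => i /= cm.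
exact: leq_trans cm mk.
Qed.

(** The subword is a prefix of a restriction of w to its large letters, and
    neither operation can raise the clearing time. *)
Lemma clearing_time_larger_before_le i w :
  clearing_time (larger_before i w) <= clearing_time w.
Proof.
apply: leq_trans (clearing_time_filter i w); rewrite /larger_before /=.
set u := [seq y <- w | i <= y]; rewrite -[in leqRHS](cat_take_drop (index i u) u).
exact: clearing_time_cat.
Qed.

Lemma clearing_time_larger_before_depth i w : uniq w -> i \in w ->
  clearing_time (larger_before i w) <= depth w.
Proof.
by move=> uw iw; have := leqnn (depth w); rewrite {1}depthP // => /allP; apply.
Qed.

Lemma depth_le_clearing_time w : uniq w -> depth w <= clearing_time w.
Proof.
move=> uw; rewrite depthP //; apply/allP => i _.
exact: clearing_time_larger_before_le.
Qed.

Lemma depth_rcons_min a w : uniq w -> all (ltn a) w ->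
  depth (rcons w a) = clearing_time w.
Proof.
move=> uw aw.
have anw : a \notin w by apply/negP => /(allP aw); rewrite /= ltnn.
have ub : uniq (rcons w a) by rewrite rcons_uniq anw.
have Ea : larger_before a (rcons w a) = w by rewrite -cats1 larger_before_cat.
apply/eqP; rewrite eqn_leq; apply/andP; split; last first.
  by rewrite -{1}Ea clearing_time_larger_before_depth // mem_rcons mem_head.
rewrite depthP //; apply/allP => i; rewrite mem_rcons inE => /predU1P[->|iw].
  by rewrite Ea.
have ai : a < i := allP aw i iw.
have -> : larger_before i (rcons w a) = larger_before i w.
  by rewrite /larger_before filter_rcons leqNgt ai.
exact: clearing_time_larger_before_le.
Qed.

Lemma larger_before_map g i w : {mono g : x y / x <= y} ->
  larger_before (g i) (map g w) = map g (larger_before i w).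
Proof.
move=> g_mono; rewrite /larger_before /= filter_map map_take.
have -> : [seq y <- w | preim g (leq (g i)) y] = [seq y <- w | i <= y].
  by apply: eq_filter => y /=; rewrite g_mono.
by rewrite index_map //; apply: incn_inj.
Qed.

Lemma depth_map g w : {mono g : x y / x <= y} -> uniq w -> depth (map g w) = depth w.
Proof.
move=> g_mono uw; have g_inj := incn_inj g_mono.
have E k : (depth (map g w) <= k) = (depth w <= k).
  rewrite !depthP ?map_inj_uniq // all_map; apply: eq_all => i /=.
  by rewrite larger_before_map // clearing_time_map.
by apply/eqP; rewrite eqn_leq E leqnn -E leqnn.
Qed.

(** * Inserting a new smallest letter *)

(** As long as letters stand to the right of a, a pass treats the other letters
    as if a were absent. The first pass with a in the last position removes it,
    so a outlives the other letters by at most one pass. *)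
Lemma clearing_time_insert_min_le a v w : all (ltn a) v -> all (ltn a) w ->
  clearing_time (v ++ a :: w) <= (clearing_time (v ++ w)).+1.
Proof.
move=> av aw; rewrite clearing_timeP; have := iter_clearing_time (v ++ w).
move: (clearing_time _) => k /eqP; elim: k v w av aw => [|k IH] v [|b w] av aw cl.
- by move: cl; rewrite cats0 /= => /eqP ->.
- by case: v cl {av}.
- rewrite iterSr cats1 early_rcons_min // -iterSr iterS.
  by move: cl; rewrite cats0 => /eqP ->.
- have /andP[ab _] := aw.
  have [t [E1 E2]] := early_insert_min w av (ltnW ab).
  have := all_early (w := v ++ b :: w) (a := ltn a).
  rewrite E2 !all_cat av aw => /(_ isT)/andP[aev at'].
  by rewrite iterSr E1; apply: IH => //; rewrite -E2 -iterSr.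
Qed.

Lemma le_clearing_time_insert_min a v w : all (ltn a) v -> all (ltn a) w ->
  clearing_time (v ++ w) <= clearing_time (v ++ a :: w).
Proof.
move=> av aw; apply: leq_trans (clearing_time_filter a.+1 (v ++ a :: w)).
by rewrite filter_cat /= ltnn (all_filterP av) (all_filterP aw).
Qed.

(** Every pass shortens the prefix v, so v is cleared before v ++ w is. From
    then on a is the first letter; it remains as long as a larger letter
    follows it, and one more pass is needed to remove it afterwards. *)
Lemma lt_clearing_time_insert_min a v w : all (ltn a) v -> all (ltn a) w ->
  size v < clearing_time (v ++ w) ->
  clearing_time (v ++ w) < clearing_time (v ++ a :: w).
Proof.
move=> av aw; case Ec: (clearing_time _) => [|k] //; rewrite ltnS => vk.
have : ~~ (clearing_time (v ++ w) <= k) by rewrite Ec ltnn.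
rewrite ltnNge !clearing_timeP {Ec}.
elim: k v w vk av aw => [|k IH] v [|b w] vk av aw ncl.
- by case: v vk ncl {av}.
- have /andP[/ltnW ab _] := aw; have [t [E1 _]] := early_insert_min w av ab.
  by rewrite /= E1; case: (early v).
- move: ncl; rewrite cats0 -size_eq0 -leqn0 => /negP[].
  by apply: leq_trans (size_iter_early _ _) _; rewrite leqn0 subn_eq0.
- have /andP[/ltnW ab _] := aw; have [t [E1 E2]] := early_insert_min w av ab.
  have := all_early (w := v ++ b :: w) (a := ltn a).
  rewrite E2 !all_cat av aw => /(_ isT)/andP[aev at'].
  rewrite iterSr E1; apply: IH => //; last by rewrite -E2 -iterSr.
  by apply: leq_trans (size_early _) _; case: (v) vk.
Qed.

(** * Sums over permutations *)

(** The new minimum is 0, the old letters being shifted up; this turns words on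
    0, ..., n - 1 into words on 0, ..., n. *)
Definition ins (p : nat) (w : seq nat) : seq nat :=
  take p (map S w) ++ 0 :: drop p (map S w).

Lemma all_gt0_mapS w : all (ltn 0) (map S w).
Proof. by rewrite all_map; apply/allP. Qed.

Lemma mono_S : {mono S : x y / x <= y}.
Proof. by []. Qed.

Lemma index0_ins p w : p <= size w -> index 0 (ins p w) = p.
Proof.
move=> pw; rewrite /ins index_cat /= addn0 size_take size_map.
have -> : (0 \in take p (map S w)) = false.
  by apply/negP => /mem_take /(allP (all_gt0_mapS w)).
by case: ltngtP pw.
Qed.

Lemma filter_ins p w : [seq y <- ins p w | 0 < y] = map S w.
Proof.
rewrite /ins filter_cat /= -filter_cat cat_take_drop.
exact/all_filterP/all_gt0_mapS.
Qed.

Lemma perm_ins p w : perm_eq (ins p w) (0 :: map S w).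
Proof. by rewrite /ins perm_catC /= perm_cons perm_catC cat_take_drop. Qed.

Lemma uniq_ins p w : uniq w -> uniq (ins p w).
Proof.
move=> uw; rewrite (perm_uniq (perm_ins p w)) /= (map_inj_uniq succn_inj) uw andbT.
by apply/negP => /(allP (all_gt0_mapS w)).
Qed.

Lemma iotaS0 n : iota 0 n.+1 = 0 :: map S (iota 0 n).
Proof. by congr (_ :: _); apply: (iotaDl 1 0 n). Qed.

Lemma uniq_permutation n w : w \in permutations (iota 0 n) -> uniq w.
Proof. by rewrite mem_permutations => /perm_uniq ->; apply: iota_uniq. Qed.

Lemma size_permutation n w : w \in permutations (iota 0 n) -> size w = n.
Proof. by rewrite mem_permutations => /perm_size; rewrite size_iota. Qed.

Lemma perm_permutations_ins n :
  perm_eq (permutations (iota 0 n.+1))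
    [seq ins p w | w <- permutations (iota 0 n), p <- iota 0 n.+1].
Proof.
apply: uniq_perm; first exact: permutations_uniq.
  apply: allpairs_uniq; rewrite ?permutations_uniq ?iota_uniq //.
  move=> [w p] [v q] /allpairsP[[w' p'] [w'P p'n [-> ->]]].
  move=> /allpairsP[[v' q'] [v'P q'n [-> ->]]] /= E.
  have Ew : w' = v'.
    by apply: (inj_map succn_inj); rewrite -(filter_ins p') -(filter_ins q') E.
  move/(congr1 (index 0)): E.
  move: p'n q'n; rewrite !mem_iota !add0n !ltnS /= => p'n q'n.
  rewrite !index0_ins ?(size_permutation w'P) ?(size_permutation v'P) // => ->.
  by rewrite Ew.
move=> u; rewrite mem_permutations iotaS0; apply/idP/allpairsP => [Pu|].
  have u0 : 0 \in u by rewrite (perm_mem Pu) mem_head.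
  case/splitPr: u / u0 Pu => a b; rewrite -cat1s perm_catCA /= perm_cons => Pab.
  have Eab : map S (map predn (a ++ b)) = a ++ b.
    rewrite -map_comp -[RHS]map_id; apply/eq_in_map => y.
    by rewrite (perm_mem Pab) => /mapP[z _ ->].
  exists (map predn (a ++ b), size a); split.
  - by rewrite mem_permutations; apply: (perm_map_inj succn_inj); rewrite Eab.
  - rewrite -iotaS0 mem_iota /= add0n; have := perm_size Pab.
    by rewrite size_map size_iota size_cat => <-; rewrite ltnS leq_addr.
  - by rewrite /ins Eab take_size_cat ?drop_size_cat.
case=> [[w p] [/= ]]; rewrite mem_permutations => Pw _ ->.
by apply: perm_trans (perm_ins p w) _; rewrite perm_cons perm_map.
Qed.

Lemma sum_permutations_ins (F : seq nat -> nat) n :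
  \sum_(w <- permutations (iota 0 n.+1)) F w =
  \sum_(w <- permutations (iota 0 n)) \sum_(0 <= p < n.+1) F (ins p w).
Proof.
rewrite (perm_big _ (perm_permutations_ins n)) big_allpairs_dep /=.
by rewrite /index_iota subn0.
Qed.

Lemma sum_permutations_iota1 (F : seq nat -> nat) n :
  \sum_(w <- permutations (iota 1 n)) F w =
  \sum_(w <- permutations (iota 0 n)) F (map S w).
Proof.
have -> : iota 1 n = map S (iota 0 n) := iotaDl 1 0 n.
rewrite -(big_map (map S) xpredT F) /=; apply: perm_big.
apply: uniq_perm; rewrite ?permutations_uniq //.
  by rewrite (map_inj_uniq (inj_map succn_inj)) permutations_uniq.
move=> u; rewrite mem_permutations; apply/idP/mapP => [Pu|[v]]; last first.
  by rewrite mem_permutations => Pv ->; apply: perm_map.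
have Eu : map S (map predn u) = u.
  rewrite -map_comp -[RHS]map_id; apply/eq_in_map => y.
  by rewrite (perm_mem Pu) => /mapP[z _ ->].
exists (map predn u) => //; rewrite mem_permutations.
by apply: (perm_map_inj succn_inj); rewrite Eu.
Qed.

Lemma sum1_permutations n : \sum_(w <- permutations (iota 0 n)) 1 = n`!.
Proof. by rewrite sum1_size size_permutations ?iota_uniq // size_iota. Qed.

Lemma all_gt0_take_drop p w :
  all (ltn 0) (take p (map S w)) && all (ltn 0) (drop p (map S w)).
Proof. by rewrite -all_cat cat_take_drop all_gt0_mapS. Qed.

Lemma clearing_time_take_drop p w :
  clearing_time (take p (map S w) ++ drop p (map S w)) = clearing_time w.
Proof. by rewrite cat_take_drop clearing_time_map. Qed.

Lemma clearing_time_ins_le p w : clearing_time (ins p w) <= (clearing_time w).+1.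
Proof.
have /andP[a1 a2] := all_gt0_take_drop p w.
by rewrite -(clearing_time_take_drop p w); apply: clearing_time_insert_min_le.
Qed.

Lemma clearing_time_ins_ge p w :
  clearing_time w + (p < clearing_time w) <= clearing_time (ins p w).
Proof.
have /andP[a1 a2] := all_gt0_take_drop p w.
rewrite -(clearing_time_take_drop p w); case: ltnP => [pc|_].
  rewrite addn1; apply: lt_clearing_time_insert_min => //.
  by apply: leq_ltn_trans pc; rewrite size_take_min geq_minl.
by rewrite addn0 le_clearing_time_insert_min.
Qed.

Lemma depth_ins_ge p w : uniq w -> depth w <= depth (ins p w).
Proof.
move=> uw; rewrite depthP //; apply/allP => i iw.
have -> : clearing_time (larger_before i w) = clearing_time (larger_before i.+1 (ins p w)).
  rewrite -[larger_before i.+1 _]larger_before_filter.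
  have -> : [seq y <- ins p w | i < y] = [seq y <- map S w | i < y].
    by rewrite -(filter_ins p w) -filter_predI; apply: eq_filter => y /=; lia.
  by rewrite larger_before_filter larger_before_map // clearing_time_map.
apply: clearing_time_larger_before_depth; first exact: uniq_ins.
by rewrite (perm_mem (perm_ins p w)) inE map_f ?orbT.
Qed.

(** The inserted letter has the first p letters of w as its larger
    predecessors. *)
Lemma depth_ins_ge_take p w : uniq w -> clearing_time (take p w) <= depth (ins p w).
Proof.
move=> uw; have /andP[a1 a2] := all_gt0_take_drop p w.
have E : larger_before 0 (ins p w) = take p (map S w).
  by rewrite larger_before_cat //; apply/allP.
rewrite -(clearing_time_map (take p w) mono_S) map_take -E.
rewrite clearing_time_larger_before_depth ?uniq_ins //.
by rewrite (perm_mem (perm_ins p w)) mem_head.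
Qed.

Lemma take_ins_lt p m w : p <= m -> p <= size w ->
  take m.+1 (ins p w) = ins p (take m w).
Proof.
move=> pm pw; rewrite /ins take_cat size_takel ?size_map //.
rewrite ltnNge (leq_trans pm) //= map_take take_takel // subSn //=.
by rewrite take_drop subnK.
Qed.

Lemma take_ins_ge p m w : m <= p -> p <= size w -> take m (ins p w) = map S (take m w).
Proof.
move=> mp pw; rewrite /ins map_take take_cat size_takel ?size_map //.
case: ltnP => pm; first by rewrite take_takel // ltnW.
have -> : m = p by lia.
by rewrite subnn take0 cats0.
Qed.

Definition sum_clearing_time n := \sum_(w <- permutations (iota 0 n)) clearing_time w.
Definition sum_depth n := \sum_(w <- permutations (iota 0 n)) depth w.

Lemma sum_ltn c m : \sum_(0 <= p < m) (p < c) = minn c m.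
Proof.
elim: m => [|m IH]; first by rewrite big_geq // minn0.
by rewrite big_nat_recr //= IH; case: ltnP; lia.
Qed.

(** Each w has clearing_time w slots, the leftmost ones, in which the insertion
    raises the clearing time. *)
Lemma sum_clearing_timeS_ge n : n.+2 * sum_clearing_time n <= sum_clearing_time n.+1.
Proof.
rewrite /sum_clearing_time sum_permutations_ins big_distrr /=.
rewrite [leqLHS]big_seq [leqRHS]big_seq; apply: leq_sum => w /size_permutation sw.
have cw : clearing_time w <= n by rewrite -sw clearing_time_le_size.
pose c := clearing_time w.
apply: (@leq_trans (\sum_(0 <= p < n.+1) (c + (p < c)))); last first.
  by apply: leq_sum => p _; apply: clearing_time_ins_ge.
rewrite big_split /= sum_nat_const_nat sum_ltn subn0 /c; lia.
Qed.

Lemma sum_clearing_timeS_le n :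
  sum_clearing_time n.+1 <= n.+1 * (sum_clearing_time n + n`!).
Proof.
rewrite -sum1_permutations -big_split big_distrr /= /sum_clearing_time.
rewrite sum_permutations_ins.
apply: leq_sum => w _; rewrite addn1.
apply: (@leq_trans (\sum_(0 <= p < n.+1) (clearing_time w).+1)).
  by apply: leq_sum => p _; apply: clearing_time_ins_le.
by rewrite sum_nat_const_nat subn0.
Qed.

Lemma sum_depth_le_clearing_time n : sum_depth n <= sum_clearing_time n.
Proof.
rewrite /sum_depth [leqLHS]big_seq [leqRHS]big_seq; apply: leq_sum => w /uniq_permutation.
exact: depth_le_clearing_time.
Qed.

(** Write g_n for the mean gap. An insertion into one of the n + 1 - r leftmost
    slots raises the gap by at most 1, and the other slots make it 0; so
    g_(n+1) <= (n + 1 - r) / (n + 1) * (g_n + 1), and g_n <= n / r follows by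
    induction. *)
Lemma sum_gap n r :
  r * \sum_(w <- permutations (iota 0 n))
        (clearing_time (take (n - r) w) - depth w) <= n * n`!.
Proof.
elim: n => [|n IH].
  by rewrite [permutations _]/= big_seq1 /= clearing_time_nil muln0.
pose g n (w : seq nat) := clearing_time (take (n - r) w) - depth w.
have step w : w \in permutations (iota 0 n) ->
  \sum_(0 <= p < n.+1) g n.+1 (ins p w) <= (n.+1 - r) * (g n w + 1).
  move=> wP; have sw := size_permutation wP; have uw := uniq_permutation wP.
  (* The whole prefix lies to the left of the new letter. *)
  have reset p : n.+1 - r <= p < n.+1 -> g n.+1 (ins p w) = 0.
    move=> /andP[rp pn]; apply/eqP; rewrite subn_eq0.
    rewrite take_ins_ge ?sw // clearing_time_map //.
    apply: leq_trans _ (depth_ins_ge_take p uw).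
    by rewrite -(subnKC rp) takeD clearing_time_cat.
  have grow p : p < n.+1 - r -> g n.+1 (ins p w) <= g n w + 1.
    move=> pr; rewrite /g; have -> : n.+1 - r = (n - r).+1 by lia.
    rewrite take_ins_lt ?sw; [|lia..].
    have := clearing_time_ins_le p (take (n - r) w).
    have := depth_ins_ge p uw.
    move: (clearing_time _) (clearing_time _) (depth _) (depth _) => a b c d; lia.
  rewrite (@big_cat_nat _ _ _ (n.+1 - r)) ?leq_subr //=.
  rewrite [X in _ + X]big_nat_cond [X in _ + X]big1 ?addn0; last first.
    by move=> p /andP[/reset].
  rewrite -[X in _ <= X * _]subn0 -sum_nat_const_nat.
  rewrite big_nat_cond [leqRHS]big_nat_cond.
  by apply: leq_sum => p /andP[/andP[_ /grow]].
have total : \sum_(w <- permutations (iota 0 n.+1)) g n.+1 w <=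
    (n.+1 - r) * (\sum_(w <- permutations (iota 0 n)) g n w + n`!).
  rewrite sum_permutations_ins -sum1_permutations -big_split big_distrr /=.
  by rewrite [leqLHS]big_seq [leqRHS]big_seq; apply: leq_sum.
have : r * \sum_(w <- permutations (iota 0 n.+1)) g n.+1 w <=
    (n.+1 - r) * (n * n`! + r * n`!).
  apply: leq_trans (leq_mul (leqnn r) total) _.
  by rewrite mulnCA leq_mul2l mulnDr leq_add2r IH orbT.
move=> /leq_trans; apply; rewrite factS mulnA -mulnDl mulnA leq_mul2r; apply/orP; right.
by case: (leqP r n.+1) => rn; nia.
Qed.

Definition pattern_invariant (F : seq nat -> nat) :=
  forall g w, {mono g : x y / x <= y} -> F (map g w) = F w.

(** The length m prefix of a uniformly random permutation has a uniformly random
    pattern. In the induction, the new minimum falls either inside the prefix,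
    which then arises by insertion from a shorter prefix, or beyond it, which
    leaves the pattern of the prefix unchanged. *)
Lemma sum_take F m n : pattern_invariant F -> m <= n ->
  m`! * \sum_(w <- permutations (iota 0 n)) F (take m w) =
  n`! * \sum_(w <- permutations (iota 0 m)) F w.
Proof.
elim: n m F => [|n IH] [|m] F invF // mn.
- by rewrite !big_seq1.
- have -> : \sum_(w <- permutations (iota 0 n.+1)) F (take 0 w) = F [::] * n.+1`!.
    rewrite -sum1_permutations big_distrr; apply: eq_bigr => w _.
    by rewrite take0 /= muln1.
  by rewrite big_seq1 mul1n mulnC.
- pose H v := \sum_(0 <= p < m.+1) F (ins p v).
  have invH : pattern_invariant H.
    move=> g w g_mono; apply: eq_bigr => p _.
    (* The shift in an insertion is undone and redone around g, and the new
       letter 0 is fixed. *)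
    pose g' x := if x is y.+1 then (g y).+1 else 0.
    have g'_mono : {mono g' : x y / x <= y}.
      by move=> [|x] [|y] //=; rewrite !ltnS g_mono.
    rewrite -[RHS](invF g') //; congr (F _).
    by rewrite /ins map_cat /= map_take map_drop -!map_comp.
  have step w : w \in permutations (iota 0 n) ->
      \sum_(0 <= p < n.+1) F (take m.+1 (ins p w)) =
      H (take m w) + (n - m) * F (take m.+1 w).
    move=> /size_permutation sw.
    rewrite (@big_cat_nat _ _ _ m.+1) //=; congr (_ + _).
      by apply: eq_big_nat => p /andP[_ pm]; rewrite take_ins_lt // sw; lia.
    rewrite -subSS -sum_nat_const_nat; apply: eq_big_nat => p /andP[mp pn].
    by rewrite take_ins_ge ?sw // invF.
  rewrite sum_permutations_ins (eq_big_seq _ step) big_split -big_distrr /=.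
  rewrite mulnDr factS -mulnA IH // /H -sum_permutations_ins.
  have [lt_mn|le_nm] := ltnP m n; last first.
    by have -> : m = n by [lia]; rewrite subnn mul0n muln0 addn0 factS mulnA.
  have IHF := IH m.+1 F invF lt_mn; rewrite factS in IHF.
  rewrite [X in _ + X]mulnCA IHF -[in RHS]/(iota 0 m.+1) factS -mulnA -mulnDl.
  by congr (_ * _); lia.
Qed.

(** * Averages and the limit *)

Local Open Scope classical_set_scope.
Local Open Scope ring_scope.

Lemma avg_depthE (R : realType) n : avg_depth R n = (sum_depth n)%:R / n`!%:R.
Proof.
rewrite /avg_depth -natr_sum sum_permutations_iota1; congr (_%:R / _).
rewrite /sum_depth big_seq [in RHS]big_seq; apply: eq_bigr => w /uniq_permutation.
by apply: depth_map.
Qed.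

Lemma avg_depth0E (R : realType) n : avg_depth0 R n = (sum_clearing_time n)%:R / n`!%:R.
Proof.
rewrite /avg_depth0 -natr_sum.
rewrite (sum_permutations_iota1 (fun w => depth (rcons w 0%N))); congr (_%:R / _).
rewrite /sum_clearing_time big_seq [in RHS]big_seq.
apply: eq_bigr => w /uniq_permutation uw.
rewrite depth_rcons_min ?clearing_time_map ?all_gt0_mapS //.
by rewrite (map_inj_uniq succn_inj).
Qed.

Lemma fact_gt0R (R : realType) n : 0 < n`!%:R :> R.
Proof. by rewrite ltr0n fact_gt0. Qed.

Lemma avg_depth0_step (R : realType) n :
  avg_depth0 R n / n.+1%:R <= avg_depth0 R n.+1 / n.+2%:R.
Proof.
rewrite !avg_depth0E factS natrM.
have := sum_clearing_timeS_ge n; rewrite -(ler_nat R) natrM.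
set a := (sum_clearing_time n)%:R; set b := (sum_clearing_time n.+1)%:R => ab.
have f0 : n`!%:R != 0 :> R by rewrite gt_eqF // fact_gt0R.
have n1 : n.+1%:R != 0 :> R by rewrite pnatr_eq0.
have n2 : n.+2%:R != 0 :> R by rewrite pnatr_eq0.
have -> : a / n`!%:R / n.+1%:R = n.+2%:R * a / (n`!%:R * n.+1%:R * n.+2%:R).
  move: f0 n1 n2; move: n`!%:R n.+1%:R n.+2%:R => x y z x0 y0 z0.
  by field; rewrite x0 y0 z0.
have -> : b / (n.+1%:R * n`!%:R) / n.+2%:R = b / (n`!%:R * n.+1%:R * n.+2%:R).
  move: f0 n1 n2; move: n`!%:R n.+1%:R n.+2%:R => x y z x0 y0 z0.
  by field; rewrite x0 y0 z0.
by rewrite ler_pM2r // invr_gt0 !mulr_gt0 ?ltr0n ?fact_gt0.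
Qed.

Lemma avg_depth0S_le (R : realType) n : avg_depth0 R n.+1 <= avg_depth0 R n + 1.
Proof.
rewrite !avg_depth0E factS natrM ler_pdivrMr ?mulr_gt0 ?fact_gt0R ?ltr0n //.
have f0 : n`!%:R != 0 :> R by rewrite gt_eqF // fact_gt0R.
have -> : ((sum_clearing_time n)%:R / n`!%:R + 1) * (n.+1%:R * n`!%:R) =
    (n.+1 * (sum_clearing_time n + n`!))%:R :> R.
  by rewrite natrM natrD; field.
by rewrite ler_nat sum_clearing_timeS_le.
Qed.

Lemma avg_depth0_addn_le (R : realType) m k :
  avg_depth0 R (m + k) <= avg_depth0 R m + k%:R.
Proof.
elim: k => [|k IH]; first by rewrite addn0 addr0.
by rewrite addnS -natr1; have := avg_depth0S_le R (m + k); lra.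
Qed.

Lemma avg_depth_le_avg_depth0 (R : realType) n : avg_depth R n <= avg_depth0 R n.
Proof.
rewrite avg_depthE avg_depth0E ler_pM2r ?invr_gt0 ?fact_gt0R //.
by rewrite ler_nat sum_depth_le_clearing_time.
Qed.

Lemma avg_depth0_le_avg_depth (R : realType) n r : (0 < r)%N -> (r <= n)%N ->
  avg_depth0 R (n - r) <= avg_depth R n + n%:R / r%:R.
Proof.
move=> r0 rn; rewrite avg_depthE avg_depth0E.
have := sum_take clearing_time_map (leq_subr r n).
have := sum_gap n r.
set T := (\sum_(w <- _) clearing_time (take _ w))%N; set G := (\sum_(w <- _) _)%N.
rewrite -/(sum_clearing_time _) => rG mT.
have TG : (T <= sum_depth n + G)%N.
  rewrite /T /G /sum_depth -big_split; apply: leq_sum => w _ /=.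
  by rewrite -leq_subLR.
have -> : (sum_clearing_time (n - r))%:R / (n - r)`!%:R = T%:R / n`!%:R :> R.
  apply/eqP; rewrite eqr_div ?pnatr_eq0 -?lt0n ?fact_gt0 //.
  by rewrite -!natrM mulnC -mT mulnC.
rewrite ler_pdivrMr ?fact_gt0R // mulrDl mulfVK ?gt_eqF ?fact_gt0R //.
apply: (@le_trans _ _ ((sum_depth n)%:R + G%:R)); first by rewrite -natrD ler_nat.
rewrite lerD2l mulrAC ler_pdivlMr ?ltr0n // -!natrM ler_nat mulnC.
exact: rG.
Qed.

(** D'_(n-1) exceeds D'_(n-r) by at most r - 1, and D_n lies between
    D'_(n-r) - n / r and D'_n. *)
Lemma avg_depth_gap (R : realType) n r : (0 < r)%N -> (r <= n)%N ->
  `|avg_depth0 R n.-1 / n%:R - avg_depth R n / n%:R| <= r%:R / n%:R + 1 / r%:R.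
Proof.
move=> r0 rn; have n0 : (0 < n)%N by exact: leq_trans rn.
have nR : 0 < n%:R :> R by rewrite ltr0n.
have rR : 0 < r%:R :> R by rewrite ltr0n.
have lower := avg_depth0_le_avg_depth R r0 rn.
have shift : avg_depth0 R n.-1 <= avg_depth0 R (n - r) + r%:R.
  have := avg_depth0_addn_le R (n - r) r.-1.
  have -> : (n - r + r.-1 = n.-1)%N by lia.
  by move/le_trans; apply; rewrite lerD2l ler_nat leq_pred.
have upper : avg_depth R n <= avg_depth0 R n.-1 + 1.
  apply: le_trans (avg_depth_le_avg_depth0 R n) _.
  by rewrite -{1}(prednK n0) avg_depth0S_le.
have r1 : 1 <= r%:R :> R by rewrite ler1n.
have nr0 : 0 <= n%:R / r%:R :> R by rewrite divr_ge0 ?ltW.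
rewrite -mulrBl normrM [X in _ * X]gtr0_norm ?invr_gt0 //.
have -> : r%:R / n%:R + 1 / r%:R = (r%:R + n%:R / r%:R) / n%:R :> R.
  by field; rewrite !gt_eqF.
rewrite ler_pM2r ?invr_gt0 // ler_norml; apply/andP; split; lra.
Qed.

Lemma avg_depth0_le (R : realType) n : avg_depth0 R n <= n%:R.
Proof.
have := avg_depth0_addn_le R 0 n; rewrite add0n.
suff -> : avg_depth0 R 0 = 0 by rewrite add0r.
by rewrite avg_depth0E /sum_clearing_time big_seq1 clearing_time_nil mul0r.
Qed.

Theorem corollary1p5 (R : realType) :
  (forall n : nat, (2 <= n)%N ->
     avg_depth0 R n.-1 / n%:R <= avg_depth0 R n / n.+1%:R) /\
  (cvgn (fun n : nat => avg_depth R n / n%:R) /\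
   (fun n : nat => avg_depth0 R n.-1 / n%:R) @ \oo -->
     limn (fun n : nat => avg_depth R n / n%:R)).
Proof.
pose a n : R := avg_depth0 R n.-1 / n%:R; pose b n : R := avg_depth R n / n%:R.
have a_step n : a n <= a n.+1.
  (* The term of index 0 is a division by 0, so it vanishes. *)
  case: n => [|n]; last exact: avg_depth0_step.
  by rewrite /a invr0 mulr0 divr_ge0 // /avg_depth0 divr_ge0 ?sumr_ge0.
split; first by case=> // n _; apply: a_step.
have a_cvg : a @ \oo --> limn a.
  apply: nondecreasing_is_cvgn; first exact/nondecreasing_seqP.
  exists 1 => _ [n _ <-]; case: n => [|n]; first by rewrite /a invr0 mulr0.
  rewrite /a ler_pdivrMr ?ltr0n // mul1r; apply: le_trans (avg_depth0_le R n) _.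
  by rewrite ler_nat.
have ab_cvg : (fun n => a n - b n) @ \oo --> (0 : R).
  apply/cvgrPdist_lt => e e0.
  have [r [r0 re]] : exists r, (0 < r)%N /\ 2 / e < r%:R.
    exists (Num.truncn (2 / e)).+1; split => //; exact: truncnS_gt.
  (* From n >= r^2 on, the bound of [avg_depth_gap] is at most 2 / r. *)
  exists (r * r)%N => //= n rn.
  have rle : (r <= n)%N by apply: leq_trans rn; exact: leq_pmulr.
  have rR : 0 < r%:R :> R by rewrite ltr0n.
  have nR : 0 < n%:R :> R by rewrite ltr0n (leq_trans r0).
  rewrite sub0r normrN; apply: le_lt_trans (avg_depth_gap R r0 rle) _.
  apply: (@le_lt_trans _ _ (2 / r%:R)).
    have : r%:R / n%:R <= 1 / r%:R :> R.
      by rewrite ler_pdivrMr // mulrAC ler_pdivlMr // mul1r -natrM ler_nat.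
    lra.
  by rewrite ltr_pdivrMr // mulrC -ltr_pdivrMr.
have b_cvg : b @ \oo --> limn a.
  have -> : b = (fun n => a n - (a n - b n)) by apply/funext => n; rewrite subKr.
  by rewrite -[limn a]subr0; apply: cvgB.
by rewrite (cvg_lim _ b_cvg) //; split => //; apply/cvg_ex; exists (limn a).
Qed.
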